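(* Let $\varphi\in\mathbb{R}[X]$ be a non-zero polynomial, let $\bm c=(c_0,\ldots,c_{2N})$ be the truncated moment sequence of the positive Borel measure $\rho=\sum_{i=1}^{r'}\lambda_i\delta_{z_i}$, for $r'\in\mathbb{N}$, $\lambda_1,\ldots,\lambda_{r'}>0$ and $z_1,\ldots,z_{r'}\in\mathbb{R}$ distinct, let $H=\operatorname{Hankel}(\bm c)$ and $r=\mathrm{rank}(H)\le N+1$. If $z_1,\ldots,z_{r'}\in\mathbb{R}\setminus\mathcal{Z}(\varphi)$, or $r=N+1$, then $\bm c$ has an atomic representing measure supported on $\mathbb{R}\setminus\mathcal{Z}(\varphi)$ with at most $r$ atoms, which is unique when $r\le N$.
   Context: $\mathcal{Z}(\varphi)=\{x\in\mathbb{R}:\varphi(x)=0\}$. $\delta_z$ is the Dirac measure at $z$. The truncated moment sequence of $\rho$ (up to degree $2N$) is given by $c_j=\int x^j\,\mathrm{d}\rho=\sum_i\lambda_iz_i^j$, $j=0,\dots,2N$. $\operatorname{Hankel}(\bm c)$ is the $(N+1)\times(N+1)$ matrix with entries $c_{i+j}$, $0\le i,j\le N$. An atomic representing measure for $\bm c$ is a finite sum $\nu=\sum_i\mu_i\delta_{x_i}$ with $\mu_i>0$, $x_i\in\mathbb{R}$ (the atoms), such that $c_j=\int x^j\,\mathrm{d}\nu$ for all $j=0,\dots,2N$; it is supported on a set if all its atoms lie in that set. *)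

(* Defs.v *)
From HB Require Import structures.
From mathcomp Require Import all_boot all_order all_algebra.
From mathcomp Require Import all_classical all_reals all_analysis.

Set Implicit Arguments.
Unset Strict Implicit.
Unset Printing Implicit Defensive.

Import Order.TTheory GRing.Theory Num.Theory.
Import numFieldNormedType.Exports.

Local Open Scope classical_set_scope.
Local Open Scope ring_scope.

Notation borel_measure R := {measure set (measurableTypeR R) -> \bar R}.

Definition zero_set (R : realType) (phi : {poly R}) : set R :=
  [set x | phi.[x] = 0].

(* [nu] equals \sum_(i < n) w_i \d_(x_i) on all Borel sets. The atoms are
   pairwise distinct and the weights positive, so [n] is the number of atoms. *)
Definition atomic_decomposition (R : realType) (nu : borel_measure R) (n : nat)
    (w x : 'I_n -> R) : Prop :=
  [/\ injective x,
      forall i, 0 < w i &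
      forall A : set (measurableTypeR R), measurable A ->
        nu A = (\sum_(i < n) (w i)%:E * \d_(x i : measurableTypeR R) A)%E].

(* As [c j] is a real number, this includes the finiteness of the moments. *)
Definition truncated_moments (R : realType) (nu : borel_measure R) (N : nat)
    (c : 'I_(2 * N).+1 -> R) : Prop :=
  forall j : 'I_(2 * N).+1,
    (\int[nu]_(x in [set: measurableTypeR R]) ((x : R) ^+ j)%:E)%E = (c j)%:E.

(* [inord] leaves the index unchanged here, since i + j <= 2 * N. *)
Definition Hankel (R : realType) (N : nat) (c : 'I_(2 * N).+1 -> R) :
    'M[R]_N.+1 :=
  \matrix_(i < N.+1, j < N.+1) c (inord (i + j)%N).

Definition atomic_representing_measure (R : realType) (N : nat)
    (c : 'I_(2 * N).+1 -> R) (K : set R) (r : nat) (nu : borel_measure R) :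
    Prop :=
  truncated_moments nu c /\
  exists (n : nat) (w x : 'I_n -> R),
    [/\ (n <= r)%N, atomic_decomposition nu w x & forall i, K (x i)].

(* Main.v *)
(* Write L(p) for the integral of p against rho. The Hankel matrix is the Gram
   matrix of L on the polynomials of degree at most N, so its rank is
   min(r', N + 1). If r <= N then r' = r and rho itself is the measure; any
   other such measure has with rho at most 2 N atoms together, and values at
   these atoms can be interpolated by a polynomial of degree less than 2 N.
   If r = N + 1, let p0 have degree at most N with L(p0 x^j) = [j = N] for
   j <= N, and let p1 be monic of degree N + 1 and L-orthogonal to all degrees
   at most N. Every q = p1 - t p0 has N + 1 distinct real roots, which are the
   nodes of a positive quadrature exact up to degree 2 N. As p0 and p1 have no
   common root, each zero of phi excludes at most one value of t. *)
Require Import Defs.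
From HB Require Import structures.
From mathcomp Require Import all_boot all_order all_algebra.
From mathcomp Require Import all_classical all_reals all_analysis.
From mathcomp Require Import measurable_realfun zify ring.

Set Implicit Arguments.
Unset Strict Implicit.
Unset Printing Implicit Defensive.

Import Order.TTheory GRing.Theory Num.Theory.
Import numFieldNormedType.Exports.

Local Open Scope classical_set_scope.
Local Open Scope ring_scope.

(** * Interpolation and roots of polynomials *)

(** Newton's scheme: a new node adds a multiple of the product that vanishes at the nodes already
    treated. Repetitions in [s] are allowed because it will be the concatenation of two lists of
    nodes. *)
Lemma poly_interpolation (F : fieldType) (s : seq F) (g : F -> F) :
  exists2 p : {poly F}, (size p <= size s)%N & {in s, forall a, p.[a] = g a}.
Proof.
elim: s => [|a s [p sp pE]]; first by exists 0; rewrite ?size_poly0.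
have [a_s|aNs] := boolP (a \in s).
  exists p => [|b]; first exact: leqW.
  by rewrite inE => /orP[/eqP->|]; apply: pE.
pose q := \prod_(b <- s) ('X - b%:P).
have qa0 : q.[a] != 0 by rewrite -rootE root_prod_XsubC.
exists (p + ((g a - p.[a]) / q.[a]) *: q) => [|b].
  rewrite (leq_trans (size_polyD _ _))// geq_max leqW//=.
  by rewrite (leq_trans (size_scale_leq _ _))// size_prod_XsubC.
rewrite inE hornerD hornerZ => /orP[/eqP->|bs].
  by rewrite divfK// addrC subrK.
have /rootP-> : root q b by rewrite root_prod_XsubC.
by rewrite mulr0 addr0 pE.
Qed.

Lemma poly_eq0_at (F : fieldType) (n : nat) (x : 'I_n -> F) (p : {poly F}) :
  injective x -> (size p <= n)%N -> (forall i, p.[x i] = 0) -> p = 0.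
Proof.
move=> xI sp p0; apply: (@roots_geq_poly_eq0 _ p (codom x)).
- by apply/allP => _ /codomP[i ->]; apply/rootP.
- exact/injectiveP.
- by rewrite size_codom card_ord.
Qed.

Lemma lagrange_basis (F : fieldType) (n : nat) (x : 'I_n -> F) :
  injective x -> exists l : 'I_n -> {poly F},
    forall i, (size (l i) <= n)%N /\ forall k, (l i).[x k] = (k == i)%:R.
Proof.
move=> xI.
suff /fin_all_exists[l lP] : forall i, exists p : {poly F},
    (size p <= n)%N /\ forall k, p.[x k] = (k == i)%:R by exists l.
move=> i.
have [p sp pE] := poly_interpolation (codom x) (fun a => (a == x i)%:R).
exists p; split=> [|k]; first by rewrite size_codom card_ord in sp.
by rewrite pE ?codom_f// (inj_eq xI).
Qed.

(** Serves twice: for [phi] it lists the nodes to avoid, for an orthogonal polynomial it isolates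
    the factor without real roots. *)
Lemma poly_split_roots (F : fieldType) (p : {poly F}) : p != 0 ->
  exists s (h : {poly F}),
    p = \prod_(a <- s) ('X - a%:P) * h /\ forall a, ~~ root h a.
Proof.
move: {2}(size p) (leqnn (size p)) => n.
elim: n p => [p|n IHn p sp p0]; first by rewrite size_poly_leq0 => ->.
have [[a /factor_theorem[q pE]]|pN] := pselect (exists a, root p a).
  have q0 : q != 0 by apply: contraNneq p0 => q0; rewrite pE q0 mul0r.
  have sq : (size q <= n)%N by move: sp; rewrite pE size_Mmonic ?monicXsubC // size_XsubC addn2.
  have [s [h [qE hN]]] := IHn _ sq q0.
  by exists (a :: s), h; split=> //; rewrite big_cons pE qE mulrC mulrA.
exists [::], p; split=> [|a]; first by rewrite big_nil mul1r.
by apply/negP => pa; apply: pN; exists a.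
Qed.

Lemma not_uniq_perm (T : eqType) (s : seq T) :
  ~~ uniq s -> exists a s', perm_eq s [:: a, a & s'].
Proof.
elim: s => [//|a s IHs] /=; rewrite negb_and negbK.
have [a_s _|_ /= /IHs[b [s' ss']]] := boolP (a \in s).
  by exists a, (rem a s); rewrite perm_cons perm_to_rem.
exists b, (a :: s'); apply: (@perm_trans _ (a :: [:: b, b & s'])).
  by rewrite perm_cons.
by rewrite -[a :: [:: b, b & s']]/([:: a] ++ [:: b; b] ++ s') perm_catCA.
Qed.

(** Intermediate value theorem; the product form spares a choice of the sign of [h]. *)
Lemma rootless_same_sign (R : rcfType) (h : {poly R}) :
  (forall a, ~~ root h a) -> forall x y, 0 < h.[x] * h.[y].
Proof.
move=> hN; suff H x y : x <= y -> 0 < h.[x] * h.[y].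
  by move=> x y; have /orP[/H//|/H] := le_total x y; rewrite mulrC.
move=> xy; have h0 a : h.[a] != 0 by rewrite -rootE hN.
rewrite ltNge; apply/negP => hxy.
wlog hx : h hN h0 hxy / h.[x] <= 0.
  move=> W; have [hx|hx] := leP h.[x] 0; first exact: (W h).
  apply: (W (- h)) => [a|a||]; rewrite ?rootN ?hornerN ?oppr_eq0 ?mulrNN//.
  by rewrite oppr_le0 ltW.
have hx0 : h.[x] < 0 by rewrite lt_neqAle h0.
have hy : 0 <= h.[y] by rewrite -(nmulr_rle0 _ hx0).
have [|c _] := @poly_ivt _ h x y xy; first by rewrite hx hy.
by rewrite (negPf (hN c)).
Qed.

(** * Quadratures and their moment matrices *)

Section Quadrature.
Variables (R : comNzRingType) (n : nat) (w x : 'I_n -> R).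

Definition quadrature (p : {poly R}) : R := \sum_i w i * p.[x i].

Lemma quadrature_is_linear : scalar quadrature.
Proof.
move=> a p q; rewrite /quadrature big_distrr -big_split; apply: eq_bigr => i _.
by rewrite hornerD hornerZ mulrDr mulrCA.
Qed.

HB.instance Definition _ :=
  GRing.isLinear.Build R {poly R} R *%R quadrature quadrature_is_linear.

Lemma quadratureXn j : quadrature 'X^j = \sum_i w i * x i ^+ j.
Proof. by apply: eq_bigr => i _; rewrite hornerXn. Qed.

Lemma quadrature_coef m (f p : {poly R}) : (size p <= m)%N ->
  quadrature (f * p) = \sum_(j < m) p`_j * quadrature (f * 'X^j).
Proof.
move=> sp; have {1}-> : p = \sum_(j < m) p`_j *: 'X^j.
  rewrite -poly_def; apply/polyP => i; rewrite coef_poly.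
  by case: ltnP => // mi; rewrite nth_default// (leq_trans sp).
rewrite mulr_sumr linear_sum; apply: eq_bigr => j _.
by rewrite -scalerAr linearZ.
Qed.

(** The Gram matrix of the form [L(p * q)] in the monomial basis, where [L] is the quadrature. *)
Definition moment_matrix m : 'M[R]_m :=
  \matrix_(i, j) quadrature 'X^(i + j).

Lemma mulmx_moment_matrix m (v : 'rV_m) j :
  (v *m moment_matrix m) 0 j = quadrature (rVpoly v * 'X^j).
Proof.
rewrite mulrC (@quadrature_coef m) ?size_poly// mxE; apply: eq_bigr => i _.
by rewrite mxE coef_rVpoly_ord -exprD addnC.
Qed.

End Quadrature.

Lemma eq_quadrature (R : comNzRingType) n (w x : 'I_n -> R)
    n' (w' x' : 'I_n' -> R) m :
  (forall j, (j < m)%N -> quadrature w x 'X^j = quadrature w' x' 'X^j) ->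
  forall p : {poly R}, (size p <= m)%N -> quadrature w x p = quadrature w' x' p.
Proof.
move=> E p sp; rewrite -[p]mul1r !(@quadrature_coef _ _ _ _ m)//.
by apply: eq_bigr => j _; rewrite !mul1r E.
Qed.

(** One polynomial of size at most [n + n'] interpolates [g] at the nodes of both quadratures, and
    they agree on it. *)
Lemma quadrature_unique (F : fieldType) n (w x : 'I_n -> F)
    n' (w' x' : 'I_n' -> F) m : (n + n' <= m)%N ->
  (forall j, (j < m)%N -> quadrature w x 'X^j = quadrature w' x' 'X^j) ->
  forall g : F -> F, \sum_i w i * g (x i) = \sum_i w' i * g (x' i).
Proof.
move=> nm E g; have [p sp pE] := poly_interpolation (codom x ++ codom x') g.
have {}sp : (size p <= m)%N.
  by rewrite (leq_trans sp)// size_cat !size_codom !card_ord.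
transitivity (quadrature w x p).
  by apply: eq_bigr => i _; rewrite pE// mem_cat codom_f.
rewrite (eq_quadrature E sp).
by apply: eq_bigr => i _; rewrite pE// mem_cat codom_f orbT.
Qed.

(** The weights are the integrals of the Lagrange basis, in which every polynomial of size at most
    [n'] expands. *)
Lemma quadrature_weights (F : fieldType) n (w x : 'I_n -> F)
    n' (x' : 'I_n' -> F) : injective x' ->
  exists w' : 'I_n' -> F,
    forall p : {poly F}, (size p <= n')%N -> quadrature w' x' p = quadrature w x p.
Proof.
move=> xI; have [l lP] := lagrange_basis xI.
exists (fun i => quadrature w x (l i)) => p sp.
suff {2}-> : p = \sum_i p.[x' i] *: l i.
  by rewrite linear_sum; apply: eq_bigr => i _; rewrite linearZ mulrC.
apply/eqP; rewrite -subr_eq0; apply/eqP/(poly_eq0_at xI) => [|i].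
  rewrite (leq_trans (size_polyD _ _))// geq_max sp size_polyN/=.
  apply: (leq_trans (size_sum _ _ _)); apply/bigmax_leqP => i _.
  by rewrite (leq_trans (size_scale_leq _ _))//; case: (lP i).
rewrite hornerD hornerN horner_sum (bigD1 i)//= big1 => [|k ki].
  by rewrite hornerZ (lP i).2 eqxx mulr1 addr0 subrr.
by rewrite hornerZ (lP k).2 eq_sym (negPf ki) mulr0.
Qed.

Lemma row_free_vandermonde (F : fieldType) n m (w x : 'I_n -> F) :
  injective x -> (forall i, w i != 0) -> (n <= m)%N ->
  row_free (\matrix_(i < n, j < m) (w i * x i ^+ j)).
Proof.
move=> xI w0 nm; apply: inj_row_free => u u0; apply/rowP => i; rewrite mxE.
(* The empty quadrature stands for the zero functional; uniqueness is then tested on the indicator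
   of the node [x i], which isolates [u 0 i * w i]. *)
have E j : (j < m)%N ->
    quadrature (fun i => u 0 i * w i) x 'X^j
    = quadrature (fun=> 0) (fun _ : 'I_0 => 0) 'X^j.
  move=> jm; rewrite quadratureXn /quadrature big_ord0.
  have /rowP/(_ (Ordinal jm)) := u0; rewrite !mxE => u0j; rewrite -[RHS]u0j.
  by apply: eq_bigr => k _; rewrite mxE mulrA.
have := @quadrature_unique _ _ _ _ _ _ _ _ _ E (fun a => (a == x i)%:R).
rewrite addn0 nm big_ord0 => /(_ isT); rewrite (bigD1 i)//= big1 => [|k ki].
  by rewrite eqxx mulr1 addr0 => /eqP; rewrite mulf_eq0 (negPf (w0 i)) orbF => /eqP.
by rewrite (inj_eq xI) (negPf ki) mulr0.
Qed.

(** * Quadratures with positive weights *)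

Section PositiveQuadrature.
Variables (R : realFieldType) (n : nat) (w x : 'I_n -> R).
Hypotheses (xI : injective x) (w_gt0 : forall i, 0 < w i).

Lemma quadrature_eq0 p : (forall a, 0 <= p.[a]) ->
  quadrature w x p = 0 -> forall i, p.[x i] = 0.
Proof.
move=> p0 /psumr_eq0P E i; apply/eqP.
have /eqP := E (fun j _ => mulr_ge0 (ltW (w_gt0 j)) (p0 (x j))) i isT.
by rewrite mulf_eq0 gt_eqF.
Qed.

Lemma quadrature_sqr_gt0 (p : {poly R}) :
  p != 0 -> (size p <= n)%N -> 0 < quadrature w x (p ^+ 2).
Proof.
move=> p0 sp; rewrite lt_def sumr_ge0 ?andbT => [|i _]; last first.
  by rewrite horner_exp mulr_ge0 ?sqr_ge0// ltW.
apply: contraNneq p0 => /quadrature_eq0 E; apply/eqP/(poly_eq0_at xI) => // i.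
apply/eqP; rewrite -sqrf_eq0 -horner_exp E// => a.
by rewrite horner_exp sqr_ge0.
Qed.

(** A kernel vector, read as a polynomial [p], satisfies [L(p ^+ 2) = 0], which positivity allows
    only for [p = 0]. *)
Lemma row_free_moment_matrix m :
  (m <= n)%N -> row_free (moment_matrix w x m).
Proof.
move=> mn; apply: inj_row_free => v v0.
suff vp0 : rVpoly v = 0 by rewrite -(rVpolyK v) vp0 linear0.
apply/eqP/negPn/negP => /quadrature_sqr_gt0; rewrite (leq_trans (size_poly _ _))//.
move=> /(_ isT); rewrite expr2 (@quadrature_coef _ _ _ _ m) ?size_poly//.
rewrite big1 ?ltxx// => j _; rewrite -mulmx_moment_matrix v0 mxE mulr0//.
Qed.

Lemma rank_moment_matrix m : \rank (moment_matrix w x m) = minn n m.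
Proof.
have [nm|mn] := leqP n m; last exact/eqP/row_free_moment_matrix/ltnW.
(* The Gram matrix factors through evaluation at the [n] nodes, and both factors have rank [n]. The
   factor [1] in [B] makes it an instance of [row_free_vandermonde]. *)
pose A := \matrix_(i < n, j < m) (w i * x i ^+ j).
pose B := \matrix_(i < n, j < m) (1 * x i ^+ j).
have -> : moment_matrix w x m = A^T *m B.
  apply/matrixP => i j; rewrite !mxE quadratureXn; apply: eq_bigr => k _.
  by rewrite !mxE mul1r exprD mulrA.
rewrite mxrankMfree ?row_free_vandermonde ?oner_eq0// mxrank_tr.
by apply/eqP/row_free_vandermonde => // i; rewrite gt_eqF.
Qed.

(** Riesz representation: the Gram matrix is invertible, so any values on the monomials arise by
    pairing with some polynomial. *)
Lemma quadrature_represent m (u : nat -> R) : (m <= n)%N ->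
  exists2 p : {poly R}, (size p <= m)%N &
    forall j, (j < m)%N -> quadrature w x (p * 'X^j) = u j.
Proof.
move=> mn; have Gu : moment_matrix w x m \in unitmx.
  by rewrite -row_free_unit row_free_moment_matrix.
exists (rVpoly ((\row_j u j) *m invmx (moment_matrix w x m))) => [|j jm].
  exact: size_poly.
rewrite -[j]/(nat_of_ord (Ordinal jm)) -mulmx_moment_matrix mulmxKV//.
by rewrite mxE.
Qed.

End PositiveQuadrature.

(** * Gauss quadratures avoiding a finite set *)

(** Orthogonality is asked only in degree less than [N], so that a whole pencil of polynomials
    qualifies. A rootless factor or a double root would give a nonnegative integrand with integral
    zero, hence a nonzero polynomial with too many roots among the nodes. *)
Lemma orthogonal_real_rooted (R : rcfType) n (w x : 'I_n -> R) N (q : {poly R}) :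
  injective x -> (forall i, 0 < w i) -> (N < n)%N ->
  q \is monic -> size q = N.+2 ->
  (forall g : {poly R}, (size g <= N)%N -> quadrature w x (q * g) = 0) ->
  exists2 s, uniq s & q = \prod_(a <- s) ('X - a%:P).
Proof.
move=> xI w0 Nn qm sq qo.
have [s [h [qE hN]]] := poly_split_roots (monic_neq0 qm).
set g := \prod_(a <- s) _ in qE.
have gm : g \is monic by rewrite monic_prod_XsubC.
have hm : h \is monic by rewrite -(monicMl _ gm) -qE.
have szE : N.+2 = (size s + size h)%N.
  by rewrite -sq qE size_monicM ?monic_neq0 // size_prod_XsubC.
have [sh|sh] := leqP (size h) 1; last first.
  (* [h] has constant sign and its degree is at least 2, so that [g] has degree
     less than [N] and the integral of [q * g = h * g ^+ 2] vanishes. *)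
  have {}sh : (2 < size h)%N.
    rewrite ltn_neqAle sh andbT; apply/eqP => h2.
    apply: (negP (hN (- h`_0))); apply/rootP.
    have h1 : h`_1 = 1 by rewrite -(monicP hm) lead_coefE -h2.
    by rewrite horner_coef -h2 !big_ord_recl big_ord0/= h1; ring.
  have gs : (size g <= N)%N by rewrite size_prod_XsubC; lia.
  suff : g = 0 by move/eqP; rewrite (negPf (monic_neq0 gm)).
  apply: (poly_eq0_at xI) => [|i]; first exact: leq_trans gs (ltnW Nn).
  (* The constant [h.[0]] corrects the sign: [h.[0] * h.[a]] is positive for every [a]. *)
  have E a : (h.[0] *: (q * g)).[a] = h.[0] * h.[a] * g.[a] ^+ 2.
    by rewrite qE hornerZ !hornerM; ring.
  have /eqP : (h.[0] *: (q * g)).[x i] = 0.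
    apply: (quadrature_eq0 w0) => [a|]; last by rewrite linearZ/= qo ?mulr0.
    by rewrite E mulr_ge0 ?sqr_ge0// ltW ?rootless_same_sign.
  by rewrite E mulf_eq0 gt_eqF ?rootless_same_sign//= sqrf_eq0 => /eqP.
have h1 : h = 1.
  have sh1 := size1_polyC sh; move: (monicP hm).
  by rewrite sh1 lead_coefC => ->.
exists s; last by rewrite qE h1 mulr1.
(* A double root leaves a square times a cofactor of degree less than [N]. *)
apply/negPn/negP => /not_uniq_perm[a [s' ss']].
pose f := \prod_(b <- s') ('X - b%:P).
have qE' : q = ('X - a%:P) ^+ 2 * f.
  by rewrite qE h1 mulr1 /g (perm_big _ ss') !big_cons expr2 -mulrA.
have sf : size f = N.
  by move: szE (perm_size ss'); rewrite h1 size_poly1 /f size_prod_XsubC/=; lia.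
have : ('X - a%:P) * f = 0.
  apply: (poly_eq0_at xI) => [|i].
    by rewrite size_monicM ?monicXsubC ?monic_neq0 ?monic_prod_XsubC // size_XsubC sf.
  have := @quadrature_eq0 _ _ w x w0 ((('X - a%:P) * f) ^+ 2) _ _ i.
  rewrite horner_exp => E; apply/eqP; rewrite -sqrf_eq0 E// => [b|].
    by rewrite horner_exp sqr_ge0.
  by rewrite -[RHS](qo f) ?sf// qE'; congr quadrature; ring.
move/eqP; rewrite mulf_eq0 polyXsubC_eq0 (negPf (monic_neq0 _))//.
exact: monic_prod_XsubC.
Qed.

(** The classical rule with [N + 1] nodes is exact up to degree [2 * N + 1]; giving up one degree
    frees the parameter [t], with which the nodes are moved off [bad]. *)
Lemma gauss_quadrature (R : rcfType) n (w x : 'I_n -> R) N (bad : seq R) :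
  injective x -> (forall i, 0 < w i) -> (N < n)%N ->
  exists w' x' : 'I_N.+1 -> R,
    [/\ injective x', forall i, 0 < w' i, forall i, x' i \notin bad &
      forall p : {poly R}, (size p <= (2 * N).+1)%N ->
        quadrature w' x' p = quadrature w x p].
Proof.
move=> xI w0 Nn.
have [p0 sp0 p0E] := quadrature_represent xI w0 (fun j => (j == N)%:R) Nn.
(* [u] is the orthogonal projection of ['X^(N.+1)] onto the polynomials of degree at most [N]. *)
have [u su uE] :=
  quadrature_represent xI w0 (fun j => quadrature w x 'X^(N.+1 + j)) Nn.
have P0E (p : {poly R}) : (size p <= N.+1)%N -> quadrature w x (p0 * p) = p`_N.
  move=> sp; rewrite (quadrature_coef _ _ _ sp) big_ord_recr/= p0E// eqxx mulr1.
  rewrite big1 ?add0r// => j _.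
  by rewrite p0E ?(ltn_eqF (ltn_ord j)) ?mulr0// ltnS ltnW.
pose p1 := 'X^(N.+1) - u.
have P1E (p : {poly R}) : (size p <= N.+1)%N -> quadrature w x (p1 * p) = 0.
  move=> sp; rewrite (quadrature_coef _ _ _ sp) big1// => j _.
  by rewrite mulrBl -exprD linearB/= uE// subrr mulr0.
have monicXnB (v : {poly R}) : (size v <= N.+1)%N ->
    'X^(N.+1) - v \is monic /\ size ('X^(N.+1) - v) = N.+2.
  move=> sv; have sXv : (size (- v) < size ('X^(N.+1) : {poly R}))%N.
    by rewrite size_polyN size_polyXn.
  split; first by rewrite monicE lead_coefDl ?lead_coefXn.
  by rewrite size_polyDl // size_polyXn.
have [p1m sp1] := monicXnB _ su.
(* At a common root, [p0 = h * ('X - a%:P)] and [p1 = g * ('X - a%:P)] give [p0 * g = p1 * h]. The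
   left side integrates to the leading coefficient 1 of [g], the right side to 0. *)
have p0p1 a : root p0 a -> ~~ root p1 a.
  move=> /factor_theorem[h p0h]; apply/negP => /factor_theorem[g p1g].
  have gm : g \is monic by move: p1m; rewrite -/p1 p1g monicMr ?monicXsubC.
  have sg : size g = N.+1.
    move: sp1; rewrite -/p1 p1g size_Mmonic ?monic_neq0 ?monicXsubC//.
    by rewrite size_XsubC addn2 => -[].
  have sh : (size h <= N.+1)%N.
    have [->|h0] := eqVneq h 0; first by rewrite size_poly0.
    by move: sp0; rewrite p0h size_Mmonic ?monicXsubC// size_XsubC addn2 => /ltnW.
  have := P0E g; rewrite sg => /(_ (leqnn _)).
  have -> : p0 * g = p1 * h by rewrite p0h p1g; ring.
  rewrite P1E// => /esym/eqP.
  by move: (monicP gm); rewrite lead_coefE sg => ->; rewrite oner_eq0.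
(* Strictly above every ratio at a point of [bad], so [t] differs from the only value that makes
   this point a root. Where [p0] vanishes the ratio is 0 by convention, and [p0p1] applies
   instead. *)
pose t := 1 + \sum_(a <- bad) `|p1.[a] / p0.[a]|.
pose q := p1 - t *: p0.
have qE : q = 'X^(N.+1) - (t *: p0 + u) by rewrite /q /p1; ring.
have [] := monicXnB (t *: p0 + u).
  rewrite (leq_trans (size_polyD _ _))// geq_max su andbT.
  exact: leq_trans (size_scale_leq _ _) _.
rewrite -qE => qm szq.
have qbad a : a \in bad -> ~~ root q a.
  move=> a_bad; rewrite /q; apply/negP => /rootP.
  rewrite hornerD hornerN hornerZ => /eqP; rewrite subr_eq0 => /eqP p1a.
  have [p0a|p0a] := boolP (root p0 a).
    have /negP := p0p1 _ p0a; apply; apply/rootP.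
    by rewrite p1a (rootP p0a) mulr0.
  have : t <= `|p1.[a] / p0.[a]| by rewrite p1a mulfK// ler_norm.
  rewrite leNgt => /negP; apply; rewrite /t (big_rem a)//=.
  by rewrite addrCA ltrDl ltr_pwDl// sumr_ge0.
have qo (g : {poly R}) : (size g <= N)%N -> quadrature w x (q * g) = 0.
  move=> sg; rewrite mulrBl -scalerAl linearB linearZ/=.
  by rewrite P1E ?leqW// P0E ?leqW// nth_default// mulr0 subrr.
have [s us qs] := orthogonal_real_rooted xI w0 Nn qm szq qo.
have ss : size s = N.+1 by apply: succn_inj; rewrite -szq qs size_prod_XsubC.
pose x' (i : 'I_N.+1) := s`_i.
have x's i : x' i \in s by rewrite mem_nth// ss.
have qx' i : q.[x' i] = 0 by apply/rootP; rewrite qs root_prod_XsubC.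
have x'I : injective x'.
  by move=> i j /eqP; rewrite nth_uniq ?ss// => /eqP/val_inj.
have [w' w'E] := quadrature_weights w x x'I.
have exact_quad (p : {poly R}) : (size p <= (2 * N).+1)%N ->
    quadrature w' x' p = quadrature w x p.
  (* The quotient has size at most [(2 * N).+1 - N.+1 = N], so its product with [q] integrates to 0;
     that product also vanishes at the new nodes. The remainder falls under [w'E]. *)
  move=> sp; rewrite (divp_eq p q) mulrC !linearD/= qo; last first.
    rewrite size_divp ?monic_neq0 // szq/= leq_subLR (leq_trans sp)//. lia.
  rewrite (w'E (p %% q)); last by have := ltn_modpN0 p (monic_neq0 qm); rewrite szq ltnS.
  congr (_ + _); apply: big1 => i _.
  by rewrite hornerM qx' mul0r mulr0.
exists w', x'; split=> // i; last first.
  by apply/negP => /qbad; rewrite rootE qx' eqxx.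
have [l lP] := lagrange_basis x'I; have [sl lE] := lP i.
have l0 : l i != 0.
  by apply: contra_neq (oner_neq0 R) => l0; move: (lE i); rewrite l0 horner0 eqxx.
(* The square has degree at most [2 * N], so the new rule is exact on it, and there only the node
   [x' i] contributes. *)
suff -> : w' i = quadrature w x (l i ^+ 2).
  exact: quadrature_sqr_gt0 (leq_trans sl Nn).
rewrite -exact_quad.
  rewrite /quadrature (bigD1 i)//= big1 => [|k ki].
    by rewrite horner_exp lE eqxx expr1n mulr1 addr0.
  by rewrite horner_exp lE (negPf ki) expr0n mulr0.
apply: (leq_trans (size_poly_exp_leq _ _)); move: (size _) sl => k; lia.
Qed.

(** * Integration against atomic measures *)

Section AtomicMeasure.
Variables (R : realType) (n : nat) (w x : 'I_n -> R).

(* The absolute values only serve to provide a nonnegative scalar for any [w]. *)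
Definition atomic_measure : borel_measure R :=
  msum (fun k => if insub k is Some i
    then mscale (`|w i|)%:nng (dirac (x i : measurableTypeR R)) : borel_measure R
    else mzero) n.

Hypotheses (w_gt0 : forall i, 0 < w i).

Lemma atomic_measureE (A : set (measurableTypeR R)) :
  atomic_measure A = (\sum_(i < n) (w i)%:E * \d_(x i : measurableTypeR R) A)%E.
Proof.
apply: eq_bigr => i _; rewrite insubT ?ltn_ord// => h /=.
rewrite /mscale/= ger0_norm ?ltW//.
by congr ((w _)%:E * \d_(x _) A)%E; apply: val_inj.
Qed.

Lemma ge0_integral_atomic_measure (f : measurableTypeR R -> R) :
  measurable_fun setT f -> (forall a, 0 <= f a) ->
  (\int[atomic_measure]_a (f a)%:E)%E = (\sum_i w i * f (x i))%:E.
Proof.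
move=> mf f0.
have mEf : measurable_fun setT (EFin \o f) by exact/measurable_EFinP.
rewrite ge0_integral_measure_sum//; last by move=> a _; rewrite lee_fin.
rewrite -sumEFin; apply: eq_bigr => i _.
rewrite insubT ?ltn_ord// => h /=.
have -> : Sub (nat_of_ord i) h = i by exact: val_inj.
rewrite ge0_integral_mscale//=; last by move=> a _; rewrite lee_fin.
rewrite integral_dirac// diracT mul1e.
by rewrite ger0_norm ?ltW.
Qed.

(** Odd powers change sign, so the integrand is split into its positive and negative parts, both of
    finite integral. *)
Lemma integral_atomic_measure (f : measurableTypeR R -> R) :
  measurable_fun setT f ->
  (\int[atomic_measure]_a (f a)%:E)%E = (\sum_i w i * f (x i))%:E.
Proof.
move=> mf; rewrite integralE -/(EFin \o f) funerpos funerneg.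
rewrite (ge0_integral_atomic_measure (measurable_funrpos mf))//.
rewrite (ge0_integral_atomic_measure (measurable_funrneg mf))//.
rewrite -EFinB -sumrB; congr (_%:E); apply: eq_bigr => i _.
by rewrite -mulrBr -[in RHS](funrposBneg f).
Qed.

End AtomicMeasure.

Lemma atomic_moments (R : realType) (nu : borel_measure R) n
    (w x : 'I_n -> R) j : atomic_decomposition nu w x ->
  (\int[nu]_(a in [set: measurableTypeR R]) ((a : R) ^+ j)%:E
   = (quadrature w x 'X^j)%:E)%E.
Proof.
case=> _ w0 nuE; rewrite (eq_measure_integral (atomic_measure w x)).
  by rewrite integral_atomic_measure ?quadratureXn//; exact: exprn_measurable.
by move=> A mA _; rewrite nuE// atomic_measureE.
Qed.

(** Uniqueness of quadratures is applied to the indicator function of [A]. *)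
Lemma atomic_measures_eq (R : realType) (nu nu' : borel_measure R) n n'
    (w x : 'I_n -> R) (w' x' : 'I_n' -> R) m :
  atomic_decomposition nu w x -> atomic_decomposition nu' w' x' ->
  (n + n' <= m)%N ->
  (forall j, (j < m)%N -> quadrature w x 'X^j = quadrature w' x' 'X^j) ->
  forall A : set (measurableTypeR R), measurable A -> nu A = nu' A.
Proof.
move=> [_ _ nuE] [_ _ nuE'] nm E A mA; rewrite nuE// nuE'//.
have := congr1 EFin (quadrature_unique nm E (\1_A : R -> R)).
by rewrite -!sumEFin.
Qed.

(** * Existence and uniqueness of the representing measure *)

Theorem theorem3p31 (R : realType) (phi : {poly R}) (N : nat)
    (c : 'I_(2 * N).+1 -> R) (rho : borel_measure R)
    (r' : nat) (lambda z : 'I_r' -> R) (r : nat) :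
  phi != 0 ->
  atomic_decomposition rho lambda z ->
  truncated_moments rho c ->
  r = \rank (Hankel c) ->
  (forall i : 'I_r', (~` zero_set phi) (z i)) \/ r = N.+1 ->
  exists nu : borel_measure R,
    atomic_representing_measure c (~` zero_set phi) r nu /\
    ((r <= N)%N ->
     forall nu' : borel_measure R,
       atomic_representing_measure c (~` zero_set phi) r nu' ->
       forall A : set (measurableTypeR R), measurable A -> nu' A = nu A).

Proof.
move=> phi0 rhoD rhoM rE hyp; have [zI l0 _] := rhoD.
have cE (j : 'I_(2 * N).+1) : c j = quadrature lambda z 'X^j.
  by have := rhoM j; rewrite (atomic_moments _ rhoD) => -[].
have HE : Hankel c = moment_matrix lambda z N.+1.
  apply/matrixP => i j; rewrite !mxE cE inordK// ltnS.
  by have := ltn_ord i; have := ltn_ord j; lia.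
have {}rE : r = minn r' N.+1 by rewrite rE HE rank_moment_matrix.
have momE n (w x : 'I_n -> R) nu : atomic_decomposition nu w x ->
    truncated_moments nu c <->
    forall j, (j < (2 * N).+1)%N -> quadrature w x 'X^j = quadrature lambda z 'X^j.
  move=> nuD; split=> [nuM j jN|E j].
    by have := nuM (Ordinal jN); rewrite (atomic_moments _ nuD) cE => -[].
  by rewrite (atomic_moments _ nuD) E// cE.
have [rN|Nr] := leqP r N.
  have {}rE : r = r' by lia.
  case: hyp => [zphi|]; last by lia.
  exists rho; split; last first.
    move=> _ nu' [nuM [n [w [x [nr nuD _]]]]].
    (* The two measures have at most [2 * r <= 2 * N] atoms together, fewer than the [2 * N + 1]
       moments on which they agree. *)
    apply: (@atomic_measures_eq _ _ _ _ _ _ _ _ _ (2 * N).+1 nuD rhoD); first by lia.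
    exact: (momE _ _ _ _ nuD).1.
  by split=> //; exists r', lambda, z; split=> //; rewrite rE.
(* Now [minn r' N.+1] exceeds [N], so [r = N.+1] and [rho] has more than [N] atoms, as
   [gauss_quadrature] requires. The list [s] contains all real zeros of [phi]. *)
have [s [h [phiE hN]]] := poly_split_roots phi0.
have [|w [x [xI w0 xs wxE]]] := @gauss_quadrature _ _ _ _ N s zI l0; first by lia.
have nuD : atomic_decomposition (atomic_measure w x) w x.
  by split=> // A _; exact: atomic_measureE.
exists (atomic_measure w x); split=> [|rN]; last by lia.
split; first by apply/(momE _ _ _ _ nuD) => j jN; rewrite wxE ?size_polyXn.
exists N.+1, w, x; split=> // i; rewrite /zero_set/= => /eqP.
rewrite phiE hornerM mulf_eq0 -!rootE root_prod_XsubC.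
by rewrite (negPf (xs i)) (negPf (hN _)).
Qed.
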